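(* For a set $X$, the correspondence sending $(\star,1_X,(-)')$ on $X$ to $(\circledast,e,(-)')$ on $\mathcal{P}(X)$, where $A\circledast B=\bigcup_{a\in A,\,b\in B}a\star b$, $e=\{1_X\}$ and $A'=\{a':a\in A\}$, gives bijections between: (i) commutative mosaics $(X,\star,1_X,(-)')$ and nonassociative relation algebras $(\mathcal{P}(X),\circledast,e)$ where $\circledast$ is commutative; (ii) hypergroups $(X,\star,1_X,(-)')$ and relation algebras $(\mathcal{P}(X),\circledast,e)$; (iii) canonical hypergroups $(X,\star,1_X,(-)')$ and commutative relation algebras $(\mathcal{P}(X),\circledast,e)$.
   Context: A binary hyperoperation on a set $X$ is a function $\star: X\times X\to\mathcal{P}(X)$; for subsets, $A\star B:=\bigcup_{a\in A,b\in B}a\star b$. It is total if $X\neq\varnothing$ and all $x\star y\neq\varnothing$; associative if $x\star(y\star z)=(x\star y)\star z$ for all $x,y,z$; commutative if $x\star y=y\star x$ for all $x,y$. $(X,\star,1_X,(-)')$, with $1_X\in X$ and $(-)':X\to X$ a function, is a mosaic if: $x\star 1_X=\{x\}=1_X\star x$ for all $x$; $1_X\in(x\star x')\cap(x'\star x)$ for all $x$; and for all $x,y,z$, $x\in y\star z$ implies $y\in x\star z'$ and $z\in y'\star x$ (reversibility). A commutative mosaic is a mosaic with $\star$ commutative. A hypergroup is a total reversible hypermonoid, i.e. a mosaic whose hyperoperation is associative and total. A canonical hypergroup is a commutative hypergroup. A nonassociative relation algebra is a Boolean algebra $A$ with a binary operation $\circledast$, an atom $e$ with $e\circledast x=x=x\circledast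 e$ for all $x$, and a unary operation $(-)'$ such that for all $x,y,z\in A$: $(x\circledast y)\wedge z=\bot \iff (x'\circledast z)\wedge y=\bot\iff (z\circledast y')\wedge x=\bot$. It is a relation algebra if $\circledast$ is associative, and is commutative if $\circledast$ is commutative. In this statement the structures on $\mathcal{P}(X)$ are on the Boolean algebra of all subsets of $X$. *)

(* Defs.v *)
From HB Require Import structures.
From mathcomp Require Import all_boot all_order.
From mathcomp Require Import boolp classical_sets functions.

Set Implicit Arguments.
Unset Strict Implicit.
Unset Printing Implicit Defensive.

Import Order.TTheory.

Local Open Scope classical_set_scope.

Definition hyperop (X : Type) := X -> X -> set X.

Definition hyperop_set (X : Type) (star : hyperop X) (A B : set X) : set X :=
  \bigcup_(a in A) \bigcup_(b in B) star a b.

Definition hyper_total (X : Type) (star : hyperop X) : Prop :=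
  [set: X] !=set0 /\ forall x y, star x y !=set0.

Definition hyper_associative (X : Type) (star : hyperop X) : Prop :=
  forall x y z,
    hyperop_set star [set x] (star y z) = hyperop_set star (star x y) [set z].

Definition hyper_commutative (X : Type) (star : hyperop X) : Prop :=
  forall x y, star x y = star y x.

Record hyper_structure (X : Type) := HyperStructure {
  hmul : hyperop X;
  hone : X;
  hinv : X -> X
}.

Definition mosaic (X : Type) (M : hyper_structure X) : Prop :=
  let: HyperStructure star one inv := M in
  [/\ forall x, star x one = [set x] /\ star one x = [set x],
      forall x, (star x (inv x) `&` star (inv x) x) one
    & forall x y z, star y z x -> star x (inv z) y /\ star (inv y) x z].

Definition commutative_mosaic (X : Type) (M : hyper_structure X) : Prop :=
  mosaic M /\ hyper_commutative (hmul M).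

Definition hypergroup (X : Type) (M : hyper_structure X) : Prop :=
  [/\ mosaic M, hyper_associative (hmul M) & hyper_total (hmul M)].

Definition canonical_hypergroup (X : Type) (M : hyper_structure X) : Prop :=
  hypergroup M /\ hyper_commutative (hmul M).

(* Boolean algebras are complemented distributive lattices with bounds; on
   [set X] the instance is inclusion, with [\bot] the empty set. *)
Definition atom (d : Order.disp_t) (A : ctbDistrLatticeType d) (e : A) : Prop :=
  e <> \bot%O /\ forall x : A, (x <= e)%O -> x = \bot%O \/ x = e.

Record ra_structure (A : Type) := RAStructure {
  ra_mul : A -> A -> A;
  ra_one : A;
  ra_conv : A -> A
}.

Definition nonassociative_relation_algebra (d : Order.disp_t)
    (A : ctbDistrLatticeType d) (S : ra_structure A) : Prop :=
  let: RAStructure mul e conv := S in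
  [/\ atom e,
      forall x, mul e x = x /\ x = mul x e
    & forall x y z : A,
        ((mul x y `&` z)%O = \bot%O <-> (mul (conv x) z `&` y)%O = \bot%O) /\
        ((mul (conv x) z `&` y)%O = \bot%O <->
         (mul z (conv y) `&` x)%O = \bot%O)].

Definition commutative_nonassociative_relation_algebra (d : Order.disp_t)
    (A : ctbDistrLatticeType d) (S : ra_structure A) : Prop :=
  nonassociative_relation_algebra S /\ commutative (ra_mul S).

Definition relation_algebra (d : Order.disp_t) (A : ctbDistrLatticeType d)
    (S : ra_structure A) : Prop :=
  nonassociative_relation_algebra S /\ associative (ra_mul S).

Definition commutative_relation_algebra (d : Order.disp_t)
    (A : ctbDistrLatticeType d) (S : ra_structure A) : Prop :=
  relation_algebra S /\ commutative (ra_mul S).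

Definition powerset_structure (X : Type) (M : hyper_structure X) :
    ra_structure (set X) :=
  RAStructure (hyperop_set (hmul M)) [set hone M] (fun A => hinv M @` A).

(* Main.v *)
Require Import Defs.
From mathcomp Require Import all_boot all_order.
From mathcomp Require Import boolp classical_sets functions.

(** Write [A # B] when the sets [A] and [B] meet (predicate [meets]). The axioms
    of a nonassociative relation algebra on [set X] then say that
    [A * B # C], [A' * C # B] and [C * B' # A] are equivalent. Evaluated at
    singletons, this is reversibility of a mosaic; conversely, since both
    [A * B] and [A'] are unions over the elements of their arguments,
    reversibility implies the laws at all sets (lemma [mosaic_powersetP]).
    Associativity and commutativity pass between points and sets in the same
    way, and totality is a consequence of associativity: if [x * y] were empty,
    so would be [x' * (x * y) = (x' * x) * y], which contains [1 * y = y].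

    So the powerset construction both preserves and reflects each class of
    structures. It is injective because its values at singletons give back the
    hyperoperation, the unit and the inverse. What remains is that every
    nonassociative relation algebra on [set X] is a powerset algebra
    (lemma [nra_powerset]). A set is determined by the sets that it meets, and
    meeting is compatible with arbitrary unions in either argument; so an
    operation with an adjoint for # preserves all unions, and is determined by
    its values at singletons. Each of [A * -], [- * B] and the converse has
    such an adjoint, by the laws above and, for the converse, by their instances
    at the unit [e]. These also make the converse an involution; it therefore
    permutes the atoms of [set X], which are the singletons, and so is the
    direct image under a function on [X]. *)

Set Implicit Arguments.
Unset Strict Implicit.
Unset Printing Implicit Defensive.

Local Open Scope classical_set_scope.

(** * Sets and the sets that they meet *)

Definition meets (X : Type) (A B : set X) : Prop := A `&` B !=set0.

Lemma singleton_inj (X : Type) : injective (@set1 X).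
Proof. by move=> x y /seteqP[/(_ x erefl)]. Qed.

Lemma meets1 (X : Type) (A : set X) x : meets A [set x] <-> A x.
Proof. by split=> [[y [Ay <-]]//|Ax]; exists x. Qed.

Lemma meets_inj (X : Type) (A B : set X) :
  (forall C, meets A C <-> meets B C) -> A = B.
Proof.
by move=> AB; apply/seteqP; split=> x /meets1 ?; apply/meets1/AB.
Qed.

Lemma meets_set0P (X : Type) (A B : set X) :
  meets A B <-> (A `&` B)%O <> \bot%O :> set X.
Proof. by split=> [/set0P/eqP //|/eqP ?]; apply/set0P. Qed.

(** An operation with an adjoint preserves unions: [F A] meets [C] exactly when
    some element [a] of [A] lies in [G C], that is, when some [F [set a]]
    meets [C]. *)
Lemma adjoint_bigcup (X Y : Type) (F : set X -> set Y) (G : set Y -> set X) :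
  (forall A C, meets (F A) C <-> meets (G C) A) ->
  forall A, F A = \bigcup_(a in A) F [set a].
Proof.
move=> FG A; apply: meets_inj => C; split.
  move=> /FG[a [GCa Aa]].
  have /FG[c [Fac Cc]] : meets (G C) [set a] by apply/meets1.
  by exists c; split=> //; exists a.
move=> [c [[a Aa Fac] Cc]]; apply/FG.
have /FG/meets1 GCa : meets (F [set a]) C by exists c.
by exists a.
Qed.

Lemma atom_set1P (X : Type) (e : set X) :
  atom e <-> exists u, e = [set u].
Proof.
split=> [[e0 emin]|[u ->]].
  have /set0P[u eu] : e != set0 by apply/eqP.
  exists u; have /emin : ([set u] <= e)%O by apply/subsetPset => _ ->.
  by case=> // /seteqP[/(_ u erefl)].
split=> [/seteqP[/(_ u erefl)]//|A /subsetPset Au].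
have [->|/set0P[v Av]] := eqVneq A set0; first by left.
right; apply/seteqP; split=> // _ ->.
by rewrite -(Au v Av).
Qed.

(** Over [set X] the three disjointness conditions become meeting conditions,
    which unlike disjointness have elements as witnesses. *)
Lemma nra_meetsP (X : Type) (mul : set X -> set X -> set X) (e : set X)
    (conv : set X -> set X) :
  nonassociative_relation_algebra (RAStructure mul e conv) <->
  [/\ exists u, e = [set u],
      forall A, mul e A = A /\ A = mul A e
    & forall A B C,
        (meets (mul A B) C <-> meets (mul (conv A) C) B) /\
        (meets (mul A B) C <-> meets (mul C (conv B)) A)].
Proof.
split=> -[/atom_set1P ae un cyc]; split=> // A B C.
  by have [h1 h2] := cyc A B C; rewrite !meets_set0P -h2 -h1.
have [] := cyc A B C; rewrite !meets_set0P.
move=> h1 h2.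
have n1 (P Q : Prop) : (~ P <-> ~ Q) -> (P <-> Q).
  by move=> [PQ QP]; split; apply: contraPP.
by split; apply: n1; rewrite -h1.
Qed.

(** * From hyperoperations to operations on sets *)

Lemma hyperop_set11 (X : Type) (star : hyperop X) x y :
  hyperop_set star [set x] [set y] = star x y.
Proof. by rewrite /hyperop_set !bigcup_set1. Qed.

Lemma hyperop_setP (X : Type) (star : hyperop X) A B c :
  hyperop_set star A B c <-> exists a b, [/\ A a, B b & star a b c].
Proof.
split=> [[a Aa [b Bb abc]]|[a [b [Aa Bb abc]]]]; first by exists a, b.
by exists a => //; exists b.
Qed.

Lemma meets_hyperop_set (X : Type) (star : hyperop X) A B C :
  meets (hyperop_set star A B) C <->
  exists a b c, [/\ A a, B b, C c & star a b c].
Proof.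
split=> [[c [/hyperop_setP[a [b [Aa Bb abc]]] Cc]]|].
  by exists a, b, c.
move=> [a [b [c [Aa Bb Cc abc]]]]; exists c; split=> //.
by apply/hyperop_setP; exists a, b.
Qed.

Lemma hyperop_set_commutativeP (X : Type) (star : hyperop X) :
  hyper_commutative star <-> commutative (hyperop_set star).
Proof.
split=> [sC|sC x y]; last by rewrite -!hyperop_set11 sC.
move=> A B; apply/seteqP; split=> c /hyperop_setP[a [b [Aa Bb abc]]];
  by apply/hyperop_setP; exists b, a; rewrite sC.
Qed.

Lemma hyperop_set_associativeP (X : Type) (star : hyperop X) :
  hyper_associative star <-> associative (hyperop_set star).
Proof.
split=> [sA|sA x y z]; last by rewrite -!hyperop_set11 sA.
move=> A B C; apply/seteqP; split=> d /hyperop_setP.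
  move=> [a [t [Aa /hyperop_setP[b [c [Bb Cc bct]]] atd]]].
  have : hyperop_set star [set a] (star b c) d.
    by apply/hyperop_setP; exists a, t.
  rewrite sA => /hyperop_setP[s [_ [abs -> scd]]].
  apply/hyperop_setP; exists s, c; split=> //.
  by apply/hyperop_setP; exists a, b.
move=> [s [c [/hyperop_setP[a [b [Aa Bb abs]]] Cc scd]]].
have : hyperop_set star (star a b) [set c] d.
  by apply/hyperop_setP; exists s, c.
rewrite -sA => /hyperop_setP[_ [t [-> bct atd]]].
apply/hyperop_setP; exists a, t; split=> //.
by apply/hyperop_setP; exists b, c.
Qed.

(** Reversibility takes the relation [1 \in x * x'] to [x \in 1 * x'']. *)
Lemma mosaic_invK (X : Type) (M : hyper_structure X) :
  mosaic M -> involutive (hinv M).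
Proof.
case: M => star one inv [un cancel rev] x /=.
have [/rev[+ _] _] := cancel x.
by rewrite (un _).2; exact: esym.
Qed.

Lemma mosaic_powersetP (X : Type) (M : hyper_structure X) :
  mosaic M <-> nonassociative_relation_algebra (powerset_structure M).
Proof.
split=> [mM|].
  have := mosaic_invK mM; case: M mM => star one inv /= [un cancel rev] invK.
  apply/nra_meetsP; split=> [|A|A B C]; first by exists one.
    split; apply/seteqP; split=> x.
    - by move=> /hyperop_setP[_ [a [-> Aa]]]; rewrite (un a).2 => ->.
    - by move=> Ax; apply/hyperop_setP; exists one, x; rewrite (un x).2.
    - by move=> Ax; apply/hyperop_setP; exists x, one; rewrite (un x).1.
    - by move=> /hyperop_setP[a [_ [Aa ->]]]; rewrite (un a).1 => ->.
  split; rewrite !meets_hyperop_set; split.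
  - move=> [a [b [c [Aa Bb Cc /rev[_ ?]]]]].
    by exists (inv a), c, b; split=> //; exists a.
  - move=> [_ [c [b [[a Aa <-] Cc Bb /rev[_ +]]]]]; rewrite invK => ?.
    by exists a, b, c.
  - move=> [a [b [c [Aa Bb Cc /rev[? _]]]]].
    by exists c, (inv b), a; split=> //; exists b.
  - move=> [c [_ [a [Cc [b Bb <-] Aa /rev[+ _]]]]]; rewrite invK => ?.
    by exists a, b, c.
case: M => star one inv /nra_meetsP /= [_ un cyc].
have star1 x : star x one = [set x] by rewrite -hyperop_set11 -(un [set x]).2.
have star1l x : star one x = [set x] by rewrite -hyperop_set11 (un [set x]).1.
have cyc1 x y z : (star x y z <-> star (inv x) z y) /\
                  (star x y z <-> star z (inv y) x).
  have := cyc [set x] [set y] [set z].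
  by rewrite !image_set1 !hyperop_set11 !meets1.
split=> [x|x|x y z yzx] //.
  split; first by apply/(cyc1 _ _ _).1; rewrite star1.
  by apply/(cyc1 _ _ _).2; rewrite star1l.
by split; [apply/(cyc1 y z x).2 | apply/(cyc1 y z x).1].
Qed.

Lemma mosaic_associative_total (X : Type) (M : hyper_structure X) :
  mosaic M -> hyper_associative (hmul M) -> hyper_total (hmul M).
Proof.
case: M => star one inv [un cancel rev] /= sA; split; first by exists one.
move=> x y.
have : hyperop_set star (star (inv x) x) [set y] y.
  apply/hyperop_setP; exists one, y; split=> //; first exact: (cancel x).2.
  by rewrite (un y).2.
by rewrite -sA => /hyperop_setP[_ [t [_ xyt _]]]; exists t.
Qed.

Lemma powerset_structure_inj (X : Type) : injective (@powerset_structure X).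
Proof.
move=> [s1 o1 i1] [s2 o2 i2] [/= eqs eqo eqi].
have -> : s1 = s2.
  by apply/funext => x; apply/funext => y; rewrite -!hyperop_set11 eqs.
have -> : o1 = o2 by apply: singleton_inj.
have -> // : i1 = i2.
apply/funext => x; apply: singleton_inj.
by rewrite -!image_set1 (congr1 (@^~ [set x]) eqi).
Qed.

(** * Relation algebras of subsets *)

Section NonassociativeRelationAlgebra.
Context (X : Type) (mul : set X -> set X -> set X) (u : X).
Context (conv : set X -> set X).
Hypothesis unit_law : forall A, mul [set u] A = A /\ A = mul A [set u].
Hypothesis schroeder : forall A B C,
  (meets (mul A B) C <-> meets (mul (conv A) C) B) /\
  (meets (mul A B) C <-> meets (mul C (conv B)) A).

(** Both sides say that [mul A B] contains the unit. *)
Lemma conv_meets A B : meets (conv A) B <-> meets (conv B) A.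
Proof.
have [] := schroeder A B [set u].
by rewrite -(unit_law (conv A)).2 (unit_law (conv B)).1 => <- <-.
Qed.

(** For all [C], both [A] and [conv (conv A)] meet [C] exactly when
    [mul (conv A) C] contains the unit. *)
Lemma convK : involutive conv.
Proof.
move=> A; apply: meets_inj => C.
have := (schroeder (conv A) C [set u]).1.
rewrite -(unit_law _).2 => <-.
have := (schroeder A [set u] C).1.
by rewrite -(unit_law _).2 => <-.
Qed.

Lemma conv_bigcup A : conv A = \bigcup_(a in A) conv [set a].
Proof. exact: (adjoint_bigcup conv_meets). Qed.

Lemma conv_sub A B : A `<=` B -> conv A `<=` conv B.
Proof.
by move=> AB; rewrite (conv_bigcup A) (conv_bigcup B); apply: bigcup_subset.
Qed.

(** An order automorphism of [set X] maps atoms to atoms. *)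
Lemma conv_set1 x : exists y, conv [set x] = [set y].
Proof.
have [y [xy _]] : meets (conv [set x]) (conv [set x]).
  by apply/conv_meets; rewrite convK; exists x.
exists y.
have sub : conv [set y] `<=` [set x].
  by rewrite -[X in _ `<=` X]convK; apply: conv_sub => _ ->.
have yx : conv [set y] x.
  by apply/meets1/conv_meets/meets1.
suff <- : conv [set y] = [set x] by rewrite convK.
by apply/seteqP; split=> // _ ->.
Qed.

Lemma conv_image : exists f : X -> X, conv = (fun A => f @` A).
Proof.
have [f fE] := choice conv_set1; exists f; apply/funext => A.
rewrite conv_bigcup; apply/seteqP; split=> y.
  by move=> [a Aa]; rewrite fE => ->; exists a.
by move=> [a Aa <-]; exists a => //; rewrite fE.
Qed.

Lemma mul_hyperop_set :
  mul = hyperop_set (fun x y => mul [set x] [set y]).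
Proof.
apply/funext => A; apply/funext => B.
rewrite (@adjoint_bigcup _ _ (mul^~ B) (fun C => mul C (conv B))); last first.
  by move=> A' C; exact: (schroeder A' B C).2.
apply: eq_bigcupr => a _.
by apply: (@adjoint_bigcup _ _ (mul [set a]) (mul (conv [set a]))) => B' C;
   exact: (schroeder [set a] B' C).1.
Qed.

End NonassociativeRelationAlgebra.

Lemma nra_powerset (X : Type) (S : ra_structure (set X)) :
  nonassociative_relation_algebra S -> exists M, powerset_structure M = S.
Proof.
case: S => mul e conv /nra_meetsP[[u ->] un cyc].
have [f ->] := conv_image un cyc.
exists (HyperStructure (fun x y => mul [set x] [set y]) u f).
by rewrite /powerset_structure /= -(mul_hyperop_set cyc).
Qed.

(** The powerset construction is a bijection from all structures on [X] onto a
    set of structures that contains all nonassociative relation algebras; so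
    it restricts to a bijection between any two classes that correspond. *)
Lemma powerset_structure_bij (X : Type) (P : set (hyper_structure X))
    (Q : set (ra_structure (set X))) :
  (forall M, P M <-> Q (powerset_structure M)) ->
  (forall S, Q S -> nonassociative_relation_algebra S) ->
  set_bij P Q (@powerset_structure X).
Proof.
move=> PQ Qnra; split=> [M /PQ//|M N _ _|S QS].
  exact: powerset_structure_inj.
have [M MS] := nra_powerset (Qnra S QS).
by exists M => //; apply/PQ; rewrite MS.
Qed.

Lemma hypergroup_powersetP (X : Type) (M : hyper_structure X) :
  hypergroup M <-> relation_algebra (powerset_structure M).
Proof.
rewrite /relation_algebra -mosaic_powersetP /= -hyperop_set_associativeP.
split=> [[]//|[mM sA]]; split=> //; exact: mosaic_associative_total.
Qed.

Theorem corollary3p12 (X : Type) :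
  [/\ set_bij (fun M : hyper_structure X => commutative_mosaic M)
        (fun S : ra_structure (set X) =>
           commutative_nonassociative_relation_algebra S)
        (@powerset_structure X),
      set_bij (fun M : hyper_structure X => hypergroup M)
        (fun S : ra_structure (set X) => relation_algebra S)
        (@powerset_structure X)
    & set_bij (fun M : hyper_structure X => canonical_hypergroup M)
        (fun S : ra_structure (set X) => commutative_relation_algebra S)
        (@powerset_structure X)].
Proof.
split; apply: powerset_structure_bij.
- move=> M; rewrite /commutative_mosaic mosaic_powersetP.
  by rewrite hyperop_set_commutativeP.
- by move=> S [].
- exact: hypergroup_powersetP.
- by move=> S [].
- move=> M; rewrite /canonical_hypergroup hypergroup_powersetP.
  by rewrite hyperop_set_commutativeP.
- by move=> S [[]].
Qed.
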